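(* Let $0<q<1$ and let $k>0$ be a real number. The only function $f:(0,\infty)\to\mathbb{R}$ which satisfies $$f(x+1)\le f(x)\quad\text{for all }x>M,\ \text{for some } M\ge 0,$$ $$f(x)\ne 0\quad\text{for all }x>0,$$ and $$\frac{1}{f(x+1)}=[x]_q^k\, f(x)\quad\text{for all }x>0,\qquad f(1)=1,$$ is $f(x)=G_q(x)^k$.
   Context: $[x]_q=\frac{1-q^x}{1-q}$. For $0<q<1$ and $x>0$, $$G_q(x)=\frac{1}{\sqrt{[2]_q}}\frac{\Gamma_{q^2}(x/2)}{\Gamma_{q^2}((x+1)/2)}=\sqrt{1-q}\;\frac{(q^{x+1};q^2)_\infty}{(q^x;q^2)_\infty},$$ where $(a;p)_\infty=\prod_{j=0}^\infty(1-ap^j)$ and $\Gamma_p(x)=\frac{(p;p)_\infty}{(p^x;p)_\infty}(1-p)^{1-x}$ for $0<p<1$.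
   Formalization: The condition f(1)=1 fails for G_q^k, since G_q(1)G_q(2)=1 and G_q(2)<G_q(1) give G_q(1)>1; so uniqueness is proved with and without f(1)=1, and that G_q^k satisfies the conditions is proved only for those other than f(1)=1. *)

(* Defs.v *)
From HB Require Import structures.
From mathcomp Require Import all_boot all_order all_algebra.
From mathcomp Require Import all_classical all_reals all_analysis.

Set Implicit Arguments.
Unset Strict Implicit.
Unset Printing Implicit Defensive.

Import Order.TTheory GRing.Theory Num.Theory.
Import numFieldTopology.Exports numFieldNormedType.Exports.

Local Open Scope classical_set_scope.
Local Open Scope ring_scope.

Section QGamma.
Context {R : realType}.
Implicit Types (a p q x k : R) (f : R -> R).

Definition qnum q x : R := (1 - q `^ x) / (1 - q).

(* [lim] of a divergent sequence is a default value; for 0 < p < 1, the only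
   case used below, the partial products converge for every a. *)
Definition qpoch a p : R :=
  lim ((fun n : nat => \prod_(0 <= j < n) (1 - a * p ^+ j)) @ \oo).

Definition qGamma p x : R :=
  qpoch p p / qpoch (p `^ x) p * (1 - p) `^ (1 - x).

Definition Gq q x : R :=
  (Num.sqrt (qnum q 2))^-1 *
  (qGamma (q ^+ 2) (x / 2) / qGamma (q ^+ 2) ((x + 1) / 2)).

(* A function on (0, +oo) is represented by a total f : R -> R whose values
   outside (0, +oo) are never constrained. *)
Definition eventually_step_nonincreasing f : Prop :=
  exists2 M : R, 0 <= M & forall x, M < x -> f (x + 1) <= f x.

Definition nonvanishing_pos f : Prop := forall x, 0 < x -> f x != 0.

(* The normalization f 1 = 1 is not part of this condition: it fails for
   f x = Gq q x `^ k, because Gq q 1 * Gq q 2 = 1 and Gq q 2 < Gq q 1. *)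
Definition reciprocal_qeq q k f : Prop :=
  forall x, 0 < x -> 1 / f (x + 1) = qnum q x `^ k * f x.

End QGamma.

(* Main.v *)
(** Both [f] and [G x = Gq q x `^ k] solve the functional equation, so their
    quotient [g] satisfies [g x * g (x + 1) = 1] and hence has period 2.  As
    [G (x + 2 n)] has a positive limit independent of [x], the eventual
    monotonicity of [f] along [x + 2 n] yields [g (x + 1) <= g x], whence [g] is
    1-periodic and [g x = 1 \/ g x = - 1].  The value -1 would make [- G]
    nonincreasing along some unit steps, but [G (x + 2) < G x]. *)

Require Import Defs.
From HB Require Import structures.
From mathcomp Require Import all_boot all_order all_algebra.
From mathcomp Require Import all_classical all_reals all_analysis.
From mathcomp Require Import ring lra.

Import Order.TTheory GRing.Theory Num.Theory.
Import numFieldTopology.Exports numFieldNormedType.Exports.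

Local Open Scope classical_set_scope.
Local Open Scope ring_scope.

(** * Convergence, positivity and tails of infinite q-Pochhammer products *)

Section Pochhammer.
Context {R : realType}.
Implicit Types a p : R.

Let qprod a p n : R := \prod_(0 <= j < n) (1 - a * p ^+ j).

Lemma qpoch_factor_itv a p j : 0 <= a < 1 -> 0 <= p <= 1 ->
  0 < 1 - a * p ^+ j <= 1.
Proof.
move=> /andP[a0 a1] /andP[p0 p1].
have pj0 : 0 <= p ^+ j by exact: exprn_ge0.
have pj1 : p ^+ j <= 1 by exact: exprn_ile1.
have : a * p ^+ j <= a by rewrite ler_piMr.
have : 0 <= a * p ^+ j by exact: mulr_ge0.
by move=> ? ?; apply/andP; split; lra.
Qed.

Lemma qprod_gt0 a p n : 0 <= a < 1 -> 0 <= p <= 1 -> 0 < qprod a p n.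
Proof.
move=> a01 p01; apply: prodr_gt0 => j _.
by have /andP[] := qpoch_factor_itv a p j a01 p01.
Qed.

(* Each factor satisfies [1 - u >= expR (- u / (1 - a))] for [0 <= u <= a], and
   the exponents sum to a geometric series. *)
Lemma qprod_ge a p n : 0 <= a < 1 -> 0 <= p < 1 ->
  expR (- (a / ((1 - a) * (1 - p)))) <= qprod a p n.
Proof.
move=> a01 /andP[p0 p1].
have p01 : 0 <= p <= 1 by rewrite p0 ltW.
have [a0 a1] : 0 <= a /\ 0 < 1 - a by case/andP: a01; rewrite subr_gt0.
have {}p1 : 0 < 1 - p by rewrite subr_gt0.
(* The factor [1 - p ^+ n] keeps the exponent equal to the partial geometric sum, which induction on
   [n] can carry; the uniform bound cannot absorb another factor. *)
suff H : expR (- (a / ((1 - a) * (1 - p)) * (1 - p ^+ n))) <= qprod a p n.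
  apply: le_trans H; rewrite ler_expR lerN2 ler_piMr //.
    by rewrite divr_ge0 // mulr_ge0 // ltW.
  by have := exprn_ge0 n p0; lra.
elim: n => [|n IH]; first by rewrite expr0 subrr mulr0 oppr0 expR0 /qprod big_nil.
rewrite /qprod big_nat_recr//= -/(qprod a p n).
have -> : - (a / ((1 - a) * (1 - p)) * (1 - p ^+ n.+1)) =
  - (a / ((1 - a) * (1 - p)) * (1 - p ^+ n)) + - (a * p ^+ n / (1 - a)).
  by rewrite exprS; field; rewrite !lt0r_neq0.
rewrite expRD ler_pM ?expR_ge0//.
have /andP[u0 u1] := qpoch_factor_itv a p n a01 p01.
have ua : a * p ^+ n <= a by rewrite ler_piMr // exprn_ile1 //; case/andP: p01.
set u := a * p ^+ n in u0 u1 ua *.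
(* After inversion, it suffices that [(1 - u)^-1 <= 1 + u / (1 - a)], which amounts to
   [0 <= u * (a - u)]. *)
rewrite expRN -[leRHS]invrK lef_pV2 ?posrE ?expR_gt0 ?invr_gt0//.
apply: le_trans (expR_ge1Dx _).
rewrite -(ler_pM2r u0) mulVf ?gt_eqF//.
have -> : (1 + u / (1 - a)) * (1 - u) = 1 + u * (a - u) / (1 - a).
  by field; rewrite gt_eqF.
by rewrite lerDl divr_ge0 ?(ltW a1)// mulr_ge0 //; lra.
Qed.

Lemma cvg_qpoch a p : 0 <= a < 1 -> 0 <= p < 1 -> qprod a p @ \oo --> qpoch a p.
Proof.
move=> a01 p01; apply: nonincreasing_is_cvgn.
  have p01' : 0 <= p <= 1 by case/andP: p01 => -> /ltW.
  apply/nonincreasing_seqP => n; rewrite /qprod big_nat_recr//=.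
  have /andP[_ factor_le1] := qpoch_factor_itv a p n a01 p01'.
  by rewrite ler_piMr// ltW// qprod_gt0.
by exists (expR (- (a / ((1 - a) * (1 - p))))) => _ [n _ <-]; exact: qprod_ge.
Qed.

(** The exponential lower bound on the partial products does not depend on [n], so it survives in
    the limit. *)
Lemma qpoch_gt0 a p : 0 <= a < 1 -> 0 <= p < 1 -> 0 < qpoch a p.
Proof.
move=> a01 p01; apply: (lt_le_trans (expR_gt0 (- (a / ((1 - a) * (1 - p)))))).
apply: limr_ge; first by apply: cvgP; exact: cvg_qpoch.
by near=> n; exact: qprod_ge.
Unshelve. all: by end_near. Qed.

(** In a partial product of [n + 1] factors the first is [1 - a], and the remaining [n] form a
    partial product for [a * p]. *)
Lemma qpochS a p : 0 <= a < 1 -> 0 <= p < 1 ->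
  qpoch a p = (1 - a) * qpoch (a * p) p.
Proof.
move=> a01 p01.
have ap01 : 0 <= a * p < 1.
  case/andP: a01 => a0 a1; case/andP: p01 => p0 p1.
  by rewrite mulr_ge0//= mulr_ilt1.
have := cvg_qpoch a p a01 p01; rewrite -cvg_shiftS => /cvg_lim <- //.
apply/cvg_lim => //.
rewrite [X in X @ _ --> _](_ : _ = fun n => (1 - a) * qprod (a * p) p n).
  by apply: cvgMl_tmp; exact: cvg_qpoch.
apply/funext => n /=; rewrite /qprod big_nat_recl//= expr0 mulr1; congr *%R.
by apply: eq_bigr => j _; rewrite exprS mulrA.
Qed.

Lemma qpoch_split a p n : 0 <= a < 1 -> 0 <= p < 1 ->
  qpoch a p = qprod a p n * qpoch (a * p ^+ n) p.
Proof.
move=> a01 p01; elim: n => [|n IH].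
  by rewrite /qprod big_nil mul1r expr0 mulr1.
rewrite IH /qprod big_nat_recr//= qpochS//; first by rewrite -!mulrA exprSr.
case/andP: a01 => a0 a1; case/andP: p01 => p0 p1.
rewrite mulr_ge0 ?exprn_ge0//= (le_lt_trans _ a1)// ler_piMr//.
by rewrite exprn_ile1 // ltW.
Qed.

(** A tail is the infinite product divided by a partial product, and the partial products tend to
    that same nonzero limit. *)
Lemma cvg_qpoch_tail a p : 0 <= a < 1 -> 0 <= p < 1 ->
  qpoch (a * p ^+ n) p @[n --> \oo] --> (1 : R).
Proof.
move=> a01 p01.
have p01' : 0 <= p <= 1 by case/andP: p01 => -> /ltW.
have N0 : qpoch a p != 0 by rewrite gt_eqF // qpoch_gt0.
rewrite -(divff N0).
rewrite [X in X @ _ --> _](_ : _ = fun n => qpoch a p * (qprod a p n)^-1).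
  by apply: cvgMl_tmp; apply: cvgV => //; exact: cvg_qpoch.
apply/funext => n; rewrite (qpoch_split a p n a01 p01) mulrAC divff ?mul1r//.
by rewrite gt_eqF // qprod_gt0.
Qed.

End Pochhammer.

(** * Functional equation, monotonicity and asymptotics of [Gq] *)

Section QGammaQuotient.
Context {R : realType}.
Variable q : R.
Hypotheses (q_gt0 : 0 < q) (q_lt1 : q < 1).
Implicit Types x k : R.

Let q2_itv : 0 <= q ^+ 2 < 1.
Proof. by rewrite exprn_ge0 ?ltW//= exprn_ilt1 ?ltW. Qed.

Lemma powR_itv01 x : 0 < x -> 0 <= q `^ x < 1.
Proof.
move=> x0; rewrite powR_ge0/=.
have := gt0_ltr_powR x0 (x := q) (y := 1).
by rewrite powR1; apply; rewrite ?nnegrE ?ltW.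
Qed.

Lemma powRSr x : q `^ (x + 1) = q `^ x * q.
Proof. by rewrite powRD ?(gt_eqF q_gt0) ?implybT// powRr1 ?ltW. Qed.

Lemma qnum_gt0 x : 0 < x -> 0 < qnum q x.
Proof.
by move=> x0; rewrite divr_gt0 ?subr_gt0//; case/andP: (powR_itv01 _ x0).
Qed.

Lemma ltr_qnumS x : 0 < x -> qnum q x < qnum q (x + 1).
Proof.
move=> x0; rewrite ltr_pM2r ?invr_gt0 ?subr_gt0// ltrD2l ltrN2 powRSr.
by rewrite gtr_pMr // powR_gt0.
Qed.

(** The factors [qpoch (q ^+ 2) (q ^+ 2)] cancel. The powers of [1 - q ^+ 2] differ by the exponent
    1/2 and leave the square root of [(1 - q) * (1 + q)], whose second factor cancels against
    [qnum q 2]. *)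
Lemma Gq_qpoch x : 0 < x ->
  Gq q x = Num.sqrt (1 - q) *
           (qpoch (q `^ (x + 1)) (q ^+ 2) / qpoch (q `^ x) (q ^+ 2)).
Proof.
move=> x0; have x10 : 0 < x + 1 by lra.
have powq2 y : (q ^+ 2) `^ (y / 2) = q `^ y.
  by rewrite -powR_mulrn ?ltW// -powRrM mulrC divfK.
have p1 : 0 < 1 - q ^+ 2 by rewrite subr_gt0; case/andP: q2_itv.
have := @powRB R (1 - q ^+ 2) (1 - x / 2) (1 - (x + 1) / 2).
rewrite (gt_eqF p1) implybT => /(_ isT).
have -> : 1 - x / 2 - (1 - (x + 1) / 2) = 2^-1 by field.
rewrite powR12_sqrt ?ltW// => sqE.
have := qpoch_gt0 _ _ q2_itv q2_itv.
have := qpoch_gt0 _ _ (powR_itv01 _ x0) q2_itv.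
have := qpoch_gt0 _ _ (powR_itv01 _ x10) q2_itv.
have := powR_gt0 (1 - (x + 1) / 2) p1.
have q1 : 0 < 1 - q by rewrite subr_gt0.
have s1q : 0 < Num.sqrt (1 + q) by rewrite sqrtr_gt0 addr_gt0.
have qnum2 : qnum q 2 = 1 + q.
  by rewrite /qnum powR_mulrn ?ltW//; field; rewrite gt_eqF.
have sE : Num.sqrt (1 - q ^+ 2) = Num.sqrt (1 - q) * Num.sqrt (1 + q).
  by rewrite -sqrtrM ?ltW//; congr Num.sqrt; ring.
rewrite /Gq /qGamma !powq2 qnum2.
move: sqE; rewrite sE.
set A := _ `^ (1 - x / 2); set B := _ `^ (1 - (x + 1) / 2) => sqE B0.
set U := qpoch (q `^ (x + 1)) _ => U0.
set V := qpoch (q `^ x) _ => V0.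
set W := qpoch (q ^+ 2) _ => W0.
have -> : A = Num.sqrt (1 - q) * Num.sqrt (1 + q) * B.
  by rewrite sqE divfK// gt_eqF.
by field; rewrite !gt_eqF.
Qed.

Lemma Gq_gt0 x : 0 < x -> 0 < Gq q x.
Proof.
move=> x0; rewrite Gq_qpoch// mulr_gt0 ?sqrtr_gt0 ?subr_gt0// divr_gt0//;
  by rewrite qpoch_gt0// powR_itv01//; lra.
Qed.

Lemma Gq_mulS x : 0 < x -> Gq q x * Gq q (x + 1) = (qnum q x)^-1.
Proof.
move=> x0; have x10 : 0 < x + 1 by lra.
have q1 : 0 < 1 - q by rewrite subr_gt0.
have b1 : 0 < 1 - q `^ x by rewrite subr_gt0; case/andP: (powR_itv01 _ x0).
have V0 : 0 < qpoch (q `^ x * q ^+ 2) (q ^+ 2).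
  apply: qpoch_gt0 => //; rewrite expr2 mulrA -!powRSr powR_itv01//; lra.
have U0 := qpoch_gt0 _ _ (powR_itv01 _ x10) q2_itv.
rewrite !Gq_qpoch// (qpochS _ _ (powR_itv01 _ x0) q2_itv).
rewrite [q `^ (x + 1 + 1)]powRSr [in X in X * q]powRSr -mulrA -expr2 in V0 *.
rewrite mulrACA -expr2 sqr_sqrtr ?ltW// /qnum invf_div.
by field; rewrite !gt_eqF.
Qed.

(** Divide the product relation [Gq_mulS] at [x + 1] by the one at [x]. *)
Lemma Gq_addr2 x : 0 < x ->
  Gq q (x + 1 + 1) = Gq q x * (qnum q x / qnum q (x + 1)).
Proof.
move=> x0; have x10 : 0 < x + 1 by lra.
have G0 := Gq_gt0 _ x0; have G1 := Gq_gt0 _ x10.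
have n0 := qnum_gt0 _ x0.
have := Gq_mulS _ x0; have := Gq_mulS _ x10.
move=> /(congr1 (fun z => z / Gq q (x + 1))).
rewrite mulrAC divff ?gt_eqF// mul1r => ->.
move=> /(congr1 (fun z => z * qnum q x)); rewrite mulVf ?gt_eqF// => E1.
have G1n0 : Gq q (x + 1) != 0 by rewrite gt_eqF.
apply: (mulIf G1n0); rewrite divfK// mulrAC mulrA E1 mul1r//.
Qed.

Lemma ltr_Gq_addr2 x : 0 < x -> Gq q (x + 1 + 1) < Gq q x.
Proof.
move=> x0; rewrite Gq_addr2// gtr_pMr ?Gq_gt0// ltr_pdivrMr ?mul1r ?ltr_qnumS//.
by rewrite qnum_gt0//; lra.
Qed.

(* Compared factor by factor, this is [(1 - b) (1 - b q^2) <= (1 - b q)^2],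
   that is, [0 <= b (1 - q)^2]. *)
Lemma ler_GqS x : 0 < x -> Gq q (x + 1) <= Gq q x.
Proof.
move=> x0; have x10 : 0 < x + 1 by lra.
have x20 : 0 < x + 1 + 1 by lra.
have U0 := qpoch_gt0 _ _ (powR_itv01 _ x0) q2_itv.
have U1 := qpoch_gt0 _ _ (powR_itv01 _ x10) q2_itv.
rewrite !Gq_qpoch// ler_pM2l ?sqrtr_gt0 ?subr_gt0//.
rewrite ler_pdivrMr// mulrAC ler_pdivlMr//.
have cvgP y (y0 : 0 < y) := cvg_qpoch _ _ (powR_itv01 y y0) q2_itv.
apply: (ler_cvg_to (cvgM (cvgP _ x20) (cvgP _ x0))
                   (cvgM (cvgP _ x10) (cvgP _ x10))).
apply: nearW => n /=; rewrite -!big_split/=; apply: ler_prod => j _.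
have p01 : 0 <= q ^+ 2 <= 1 by case/andP: q2_itv => -> /ltW.
have /andP[f0 _] := qpoch_factor_itv _ _ j (powR_itv01 _ x20) p01.
have /andP[f1 _] := qpoch_factor_itv _ _ j (powR_itv01 _ x0) p01.
rewrite mulr_ge0 ?(ltW f0) ?(ltW f1)//= !powRSr -subr_ge0.
set b := q `^ x; set r := _ ^+ j.
have -> : (1 - b * q * r) * (1 - b * q * r) - (1 - b * q * q * r) * (1 - b * r) =
  b * r * (1 - q) ^+ 2 by ring.
by rewrite !mulr_ge0 ?powR_ge0 ?exprn_ge0 ?subr_ge0 ?ltW.
Qed.

(** Adding [2 * n] to [x] multiplies both Pochhammer arguments by [(q ^+ 2) ^+ n], so numerator and
    denominator become tails tending to 1. *)
Lemma cvg_Gq x : 0 < x ->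
  Gq q (x + (2 * n)%:R) @[n --> \oo] --> Num.sqrt (1 - q).
Proof.
move=> x0; have x10 : 0 < x + 1 by lra.
rewrite (_ : Num.sqrt (1 - q) = Num.sqrt (1 - q) * (1 / 1));
  last by rewrite divr1 mulr1.
rewrite [X in X @ _ --> _](_ : _ = fun n => Num.sqrt (1 - q) *
  (qpoch (q `^ (x + 1) * (q ^+ 2) ^+ n) (q ^+ 2) *
  (qpoch (q `^ x * (q ^+ 2) ^+ n) (q ^+ 2))^-1)).
  apply: cvgMl_tmp; apply: cvgM;
    first exact: cvg_qpoch_tail (powR_itv01 _ x10) q2_itv.
  by apply: cvgV; [exact: oner_neq0 | exact: cvg_qpoch_tail (powR_itv01 _ x0) q2_itv].
have powD y n : q `^ (y + (2 * n)%:R) = q `^ y * (q ^+ 2) ^+ n.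
  by rewrite powRD ?(gt_eqF q_gt0) ?implybT// powR_mulrn ?ltW// exprM.
apply/funext => n; rewrite Gq_qpoch ?ltr_wpDr// addrAC.
by rewrite !powD.
Qed.

Lemma continuous_powR_base k x : 0 < x ->
  {for x, continuous (fun y : R => y `^ k)}.
Proof.
move=> x0; apply: differentiable_continuous; apply/derivable1_diffP.
by apply: derivable_powR; rewrite in_itv/= x0.
Qed.

Lemma reciprocal_qeq_Gq k : reciprocal_qeq q k (fun x => Gq q x `^ k).
Proof.
move=> x x0; have x10 : 0 < x + 1 by lra.
have G0 := Gq_gt0 _ x0; have G1 := Gq_gt0 _ x10.
rewrite div1r -powRM ?ltW// ?qnum_gt0// -powRN.
have -> : qnum q x * Gq q x = (Gq q (x + 1))^-1.
  by rewrite -[qnum q x]invrK -Gq_mulS// invfM mulrAC mulVf ?gt_eqF// mul1r.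
by rewrite -powR_inv1 ?ltW// -powRrM mulN1r.
Qed.

End QGammaQuotient.

(** * Comparison with a positive solution for a general coefficient [c] *)

Section Uniqueness.
Context {R : realType}.
Variables (c f G : R -> R) (l : R).
Hypotheses (l_gt0 : 0 < l) (G_gt0 : forall x, 0 < x -> 0 < G x)
  (cvg_G : forall x, 0 < x -> G (x + (2 * n)%:R) @[n --> \oo] --> l)
  (G_addr2 : forall x, 0 < x -> G (x + 1 + 1) < G x)
  (G_eq : forall x, 0 < x -> 1 / G (x + 1) = c x * G x).
Hypotheses (f_mono : eventually_step_nonincreasing f)
  (f_neq0 : nonvanishing_pos f)
  (f_eq : forall x, 0 < x -> 1 / f (x + 1) = c x * f x).

Lemma reciprocal_eq_unique x : 0 < x -> f x = G x.
Proof.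
have [g fE] : exists g, forall x, 0 < x -> f x = g x * G x.
  by exists (fun x => f x / G x) => y y0; rewrite divfK// gt_eqF// G_gt0.
have [M M0 fM] := f_mono.
have g_mulS y : 0 < y -> g y * g (y + 1) = 1.
  move=> y0; have y10 : 0 < y + 1 by lra.
  have G0 : G y != 0 by rewrite gt_eqF// G_gt0.
  have G1 : G (y + 1) != 0 by rewrite gt_eqF// G_gt0.
  have f1 := f_neq0 _ y10.
  have c0 : c y * G y != 0.
    by rewrite -G_eq// mulf_neq0 ?oner_neq0// invr_eq0.
  have E : c y * G y * G (y + 1) = 1 by rewrite -G_eq// divfK.
  have : c y * f y * f (y + 1) = 1 by rewrite -f_eq// divfK.
  rewrite !fE// -[RHS]E => E'.
  have n0 : c y * G y * G (y + 1) != 0 by rewrite mulf_neq0.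
  apply: (mulfI n0); rewrite mulr1 -[RHS]E'; ring.
have g_addr2 y : 0 < y -> g (y + 1 + 1) = g y.
  move=> y0; have y10 : 0 < y + 1 by lra.
  have g1 : g (y + 1) != 0.
    by apply/eqP => g1; have := g_mulS y y0;
       rewrite g1 mulr0 => /eqP; rewrite eq_sym oner_eq0.
  by apply: (mulfI g1); rewrite g_mulS// mulrC g_mulS.
have g_add2n n y : 0 < y -> g (y + (2 * n)%:R) = g y.
  move=> y0; elim: n => [|n IH]; first by rewrite muln0 addr0.
  have -> : y + (2 * n.+1)%:R = y + (2 * n)%:R + 1 + 1 :> R.
    by rewrite mulnS addnC natrD !addrA.
  by rewrite g_addr2// ltr_wpDr.
have g_step y : 0 < y -> g (y + 1) <= g y.
  move=> y0; have y10 : 0 < y + 1 by lra.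
  (* By periodicity [g (y + 1) * l] and [g y * l] are the limits of [f] along [y + 1 + 2 n] and
     [y + 2 n], which are unit steps of [f] lying beyond [M] for large [n]. *)
  rewrite -(ler_pM2r l_gt0).
  apply: (ler_cvg_to (cvgMl_tmp (cvg_G _ y10)) (cvgMl_tmp (cvg_G _ y0))).
  near=> n.
  rewrite -(g_add2n n _ y10) -(g_add2n n _ y0) -!fE ?ltr_wpDr//.
  rewrite addrAC; apply: fM.
  have Mn : M < n%:R by near: n; exact: nbhs_infty_gtr.
  apply: (lt_le_trans Mn); rewrite natrM.
  have : (0 : R) <= n%:R by [].
  by lra.
have g_sqr y : 0 < y -> g y ^+ 2 = 1.
  move=> y0; have y10 : 0 < y + 1 by lra.
  suff E : g (y + 1) = g y by rewrite expr2 -{2}E g_mulS.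
  (* The reverse inequality is [g_step] at [y + 1], since [g (y + 2) = g y]. *)
  by apply/eqP; rewrite eq_le g_step//= -[leLHS]g_addr2// g_step.
move=> x0; rewrite fE//.
have /eqP := g_sqr _ x0; rewrite sqrf_eq1 => /orP[/eqP ->|/eqP gN1].
  by rewrite mul1r.
(* An even shift moves the point beyond [M] while preserving the value -1 of [g]. *)
have [n Mn] : exists n : nat, M < x + (2 * n)%:R.
  exists (Num.bound M); apply: (lt_le_trans (archi_boundP M0)).
  by rewrite mul2n -addnn natrD addrA lerDr addr_ge0 ?ltW.
have {}gN1 := etrans (g_add2n n _ x0) gN1.
have y0 : 0 < x + (2 * n)%:R by rewrite ltr_wpDr.
move: (x + _) Mn gN1 y0 => y Mn gN1 y0.
have y20 : 0 < y + 1 + 1 by lra.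
(* Two unit steps are chained because the strict decrease of [G] is given over steps of length 2. *)
have : f (y + 1 + 1) <= f y.
  by apply: le_trans (fM _ _) (fM _ Mn); rewrite ltr_wpDr.
by rewrite !fE// g_addr2// gN1 !mulN1r lerN2 leNgt G_addr2.
Unshelve. all: by end_near. Qed.

End Uniqueness.

Theorem theorem4p3 (R : realType) (q k : R)
    (q_gt0 : 0 < q) (q_lt1 : q < 1) (k_gt0 : 0 < k) :
  (forall f : R -> R,
      eventually_step_nonincreasing f ->
      nonvanishing_pos f ->
      reciprocal_qeq q k f ->
      f 1 = 1 ->
      forall x : R, 0 < x -> f x = Gq q x `^ k) /\
  (forall f : R -> R,
      [/\ eventually_step_nonincreasing f,
          nonvanishing_pos f &
          reciprocal_qeq q k f] <->
      (forall x : R, 0 < x -> f x = Gq q x `^ k)).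
Proof.
have GqX_gt0 x : 0 < x -> 0 < Gq q x `^ k.
  by move=> x0; rewrite powR_gt0 ?Gq_gt0.
have uniq (f : R -> R) : eventually_step_nonincreasing f ->
    nonvanishing_pos f -> reciprocal_qeq q k f ->
    forall x, 0 < x -> f x = Gq q x `^ k.
  have l0 : 0 < Num.sqrt (1 - q) by rewrite sqrtr_gt0 subr_gt0.
  move=> f_mono f_neq0 f_qeq x x0.
  apply: (reciprocal_eq_unique (fun x => qnum q x `^ k) f
    (fun x => Gq q x `^ k) (Num.sqrt (1 - q) `^ k)) => //.
  - by rewrite powR_gt0.
  - move=> y y0; apply: (continuous_cvg _ (continuous_powR_base k _ l0)).
    exact: cvg_Gq.
  - move=> y y0; have y20 : 0 < y + 1 + 1 by lra.
    by rewrite gt0_ltr_powR// ?nnegrE ?(ltW (Gq_gt0 _ _ _ _ _))// ltr_Gq_addr2.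
  - exact: reciprocal_qeq_Gq.
split=> [f f_mono f_neq0 f_qeq _|f]; first exact: uniq.
split=> [[]|fE]; first exact: uniq.
split.
(* The threshold 0 works because [ler_GqS] holds at every positive point and raising to the power
   [k] preserves order. *)
- exists 0 => // x x0; have x10 : 0 < x + 1 by lra.
  rewrite !fE//; apply: (ge0_ler_powR (ltW k_gt0)); last exact: ler_GqS.
    by rewrite nnegrE ltW// Gq_gt0.
  by rewrite nnegrE ltW// Gq_gt0.
- by move=> x x0; rewrite fE// gt_eqF// GqX_gt0.
- move=> x x0; rewrite !fE//; last by lra.
  exact: reciprocal_qeq_Gq.
Qed.
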